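(* Let $p\ne2$ be a prime and let $0\le i\le p^f-2$. Define $$F_i(x)=\sum_{m\ge0}\frac{\left(\omega(\phi)^i-(-1)^m\omega(\bar\phi)^i\right)\left(\log_p\frac{\phi}{\omega(\phi)}\right)^m}{m!\,\sqrt5}\,x^m .$$ Then this series defines a function $F_i:\mathbb{Z}_p\to\mathbb{Z}_p$, and with $A_i=\{n\ge0:n\equiv i\pmod{p^f-1}\}$, the family $\{(F_i,A_i):0\le i\le p^f-2\}$ is a twisted interpolation of the Fibonacci sequence $F(n)_{n\ge0}$ to $\mathbb{Z}_p$; that is, each $F_i$ is continuous and $F(n)=F_i(n)$ for all $n\in A_i$.
   Context: $F(0)=0$, $F(1)=1$, $F(n+2)=F(n+1)+F(n)$. Let $K=\mathbb{Q}_p(\phi)$ where $\phi,\bar\phi$ are the two roots of $x^2-x-1$, and $\sqrt5:=2\phi-1$. Let $|\cdot|_p$ be the unique extension to $K$ of the $p$-adic absolute value, $e$ the ramification index, $d=[K:\mathbb{Q}_p]$, $f=d/e$, and $\pi$ a uniformizer (an element with $|\pi|_p=p^{-1/e}$). The residue field of $\mathcal O_K=\{x:|x|_p\le1\}$ has $p^f$ elements; for $x\in\mathcal O_K$, $x\not\equiv0\pmod\pi$, $\omega(x)$ is the unique $(p^f-1)$-st root of unity in $\mathcal O_K$ congruent to $x$ modulo $\pi$. $\log_p y=\sum_{m\ge1}(-1)^{m+1}(y-1)^m/m$ is the $p$-adic logarithm, defined for $|y-1|_p<1$. *)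

(* Defs.v *)
From HB Require Import structures.
From mathcomp Require Import all_boot all_order all_algebra.
From mathcomp Require Import reals.
From Stdlib Require Import ClassicalEpsilon.
Set Implicit Arguments. Unset Strict Implicit. Unset Printing Implicit Defensive.
Import Order.TTheory GRing.Theory Num.Theory.
Local Open Scope ring_scope.

Fixpoint fib (n : nat) : nat :=
  match n with
  | 0 => 0
  | S m => match m with 0 => 1 | S k => fib m + fib k end
  end%N.

Section PadicField.
Variables (R : realType) (K : fieldType) (abs : K -> R).

Definition padic_abs (p : nat) : Prop :=
  [/\ forall x, 0 <= abs x,
      forall x, abs x = 0 <-> x = 0,
      forall x y, abs (x * y) = abs x * abs y,
      forall x y, abs (x + y) <= Num.max (abs x) (abs y)
    & forall n : nat, (0 < n)%N -> abs n%:R = (p%:R ^- (logn p n) : R)].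

Definition cvg_to (u : nat -> K) (l : K) : Prop :=
  forall eps : R, 0 < eps -> exists N, forall n, (N <= n)%N -> abs (u n - l) < eps.

Definition cauchy_seq (u : nat -> K) : Prop :=
  forall eps : R, 0 < eps -> exists N, forall m n, (N <= m)%N -> (N <= n)%N ->
    abs (u m - u n) < eps.

Definition complete_abs : Prop :=
  forall u, cauchy_seq u -> exists l, cvg_to u l.

Definition series_to (a : nat -> K) (l : K) : Prop :=
  cvg_to (fun n => \sum_(m < n) a m) l.

Definition in_closure (S : K -> Prop) (x : K) : Prop :=
  forall eps : R, 0 < eps -> exists y, S y /\ abs (x - y) < eps.

Definition is_Zp (x : K) : Prop := in_closure (fun y => exists z : int, y = z%:~R) x.
Definition is_Qp (x : K) : Prop := in_closure (fun y => exists r : rat, y = ratr r) x.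

Definition residue_card (q : nat) : Prop :=
  exists s : seq K,
    [/\ size s = q,
        forall j, (j < q)%N -> abs s`_j <= 1,
        forall j k, (j < q)%N -> (k < q)%N -> j <> k -> 1 <= abs (s`_j - s`_k)
      & forall x, abs x <= 1 -> exists2 j, (j < q)%N & abs (x - s`_j) < 1].

Definition omega (q : nat) (x : K) : K :=
  epsilon (inhabits 0) (fun w => w ^+ q.-1 = 1 /\ abs (w - x) < 1).

Definition plog (y : K) : K :=
  epsilon (inhabits 0)
    (series_to (fun k => (-1) ^+ k * (y - 1) ^+ k.+1 / k.+1%:R)).

(* m-th term of F_i(x); phibar = 1 - phi, sqrt5 = 2 phi - 1 *)
Definition Fterm (q i : nat) (phi x : K) (m : nat) : K :=
  (omega q phi ^+ i - (-1) ^+ m * omega q (1 - phi) ^+ i)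
    * plog (phi / omega q phi) ^+ m / (m`!%:R * (2 * phi - 1)) * x ^+ m.

Definition Fval (q i : nat) (phi x : K) : K :=
  epsilon (inhabits 0) (series_to (Fterm q i phi x)).

End PadicField.

(* Main.v *)
Require Import Defs.
From HB Require Import structures.
From mathcomp Require Import all_boot all_order all_algebra.
From mathcomp Require Import reals zify ring lra.
From Stdlib Require Import ClassicalEpsilon.
Set Implicit Arguments. Unset Strict Implicit. Unset Printing Implicit Defensive.
Import Order.TTheory GRing.Theory Num.Theory.
Local Open Scope ring_scope.

(** Put [u = phi / omega phi] and [L = log u].  As [omega (1 - phi) = - 1 / omega phi],
    [F_i x = (omega phi ^ i exp (x L) - omega (1 - phi) ^ i exp (- x L)) / sqrt 5], so
    [exp L = u] and Binet's formula give [F_i n = fib n] on [A_i].  All series are controlled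
    by [s = p ^ (- 1 / (p - 1))]: [|m!| >= s ^ m], and [|u - 1| <= s ^ 2], because
    [|u - 1| = |phi ^ (q - 1) - 1|] and [phi ^ (q - 1) - 1] is an integer combination of
    [1] and [phi].  Finally [x |-> exp (x L)] is 1-Lipschitz on [Z_p], and [A_i] is dense in
    [Z_p], so [F_i] is continuous with values in the closure of the integers. *)

(** * Geometric sequences and valuations of integers *)

Lemma geometric_lt (R : realType) (s eps : R) :
  0 <= s -> s < 1 -> 0 < eps -> exists n, s ^+ n < eps.
Proof.
move=> s_ge0 s_lt1 eps_gt0; have [s0|s_neq0] := eqVneq s 0.
  by exists 1%N; rewrite expr1 s0.
have s_gt0 : 0 < s by rewrite lt0r s_neq0.
pose a := s^-1 - 1.
have a_gt0 : 0 < a by rewrite subr_gt0 invf_gt1.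
(* Bernoulli's inequality; with the Archimedean property it makes the powers of [s^-1] exceed
   [eps^-1]. *)
have bern n : 1 + n%:R * a <= s^-1 ^+ n.
  elim: n => [|n IHn]; first by rewrite mul0r addr0 expr0.
  have -> : s^-1 = 1 + a by rewrite /a addrC subrK.
  rewrite exprS; have := ler_wpM2l _ IHn (x := 1 + a).
  have -> : s^-1 = 1 + a by rewrite /a addrC subrK.
  move=> /(_ (addr_ge0 ler01 (ltW a_gt0))); apply: le_trans.
  have := mulr_ge0 (ler0n R n) (mulr_ge0 (ltW a_gt0) (ltW a_gt0)).
  by rewrite -natr1; lra.
exists (Num.bound (eps^-1 / a)).
have := archi_boundP (divr_ge0 (ltW (_ : 0 < eps^-1)) (ltW a_gt0)).
rewrite invr_gt0 => /(_ eps_gt0); rewrite ltr_pdivrMr // => H.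
rewrite -ltf_pV2 ?qualifE /= ?exprn_gt0 // -exprVn.
by apply: lt_le_trans H (le_trans _ (bern _)); rewrite lerDr.
Qed.

(** The intermediate value theorem for ['X^n - c^-1] on [0, 1]; it supplies the real number
    [p ^ (- 1 / (p - 1))]. *)
Lemma exists_root_invr (R : realType) (n : nat) (c : R) :
  (0 < n)%N -> 1 < c -> exists s : R, [/\ 0 < s, s < 1 & s ^+ n = c^-1].
Proof.
move=> n_gt0 c_gt1; have c_gt0 : 0 < c by apply: lt_trans c_gt1.
have := @poly_ivt R ('X^n - c^-1%:P) 0 1.
rewrite !hornerE ?hornerXn expr1n expr0n eqn0Ngt n_gt0 /= sub0r oppr_le0.
case; [exact: ler01 | by rewrite invr_ge0 (ltW c_gt0) subr_ge0 invf_le1 // ltW|].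
move=> s /andP[s_ge0 s_le1]; rewrite rootE !hornerE ?hornerXn subr_eq0 => /eqP sn.
exists s; split => //; rewrite lt_neqAle ?s_ge0 ?s_le1 andbT.
- rewrite eq_sym; apply/eqP => s0; move: sn.
  by rewrite s0 expr0n eqn0Ngt n_gt0 => /esym/eqP; rewrite invr_eq0 gt_eqF.
- apply/eqP => s1; move: sn; rewrite s1 expr1n => /esym/eqP.
  by rewrite invr_eq1 gt_eqF.
Qed.

(** Bernoulli's inequality [(p - 1) k < p ^ k] for [k = logn p n.+1], where [p ^ k] divides
    [n.+1]. *)
Lemma logn_lt (p n : nat) : prime p -> (p.-1 * logn p n.+1 <= n)%N.
Proof.
move=> p_pr; rewrite -ltnS; apply: leq_trans (dvdn_leq _ (pfactor_dvdnn p n.+1)) => //.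
have p_gt0 := prime_gt0 p_pr; elim: (logn p n.+1) => [|k IHk]; first by rewrite muln0.
by rewrite expnS mulnS; move: (expn_gt0 p k); rewrite p_gt0 => /=; nia.
Qed.

(** Legendre's formula. The induction carries the extra term [n %/ p ^ k], which makes the truncated
    sums telescope. *)
Lemma logn_fact_le (p n : nat) : prime p -> (p.-1 * logn p n`! <= n)%N.
Proof.
move=> p_pr; rewrite logn_fact //; have p_gt0 := prime_gt0 p_pr.
have step k : (p.-1 * (\sum_(1 <= j < k.+1) n %/ p ^ j) + n %/ p ^ k <= n)%N.
  elim: k => [|k IHk]; first by rewrite big_geq // muln0 expn0 divn1.
  rewrite big_nat_recr //=; apply: leq_trans IHk; rewrite mulnDr -addnA leq_add2l.
  have := leq_divM (n %/ p ^ k) p; rewrite -divnMA -expnSr.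
  by move: (n %/ _)%N => a; nia.
exact: leq_trans (leq_addr _ _) (step n).
Qed.

(** * Arithmetic of the ultrametric absolute value *)

Section PadicAbs.
Variables (R : realType) (K : fieldType) (abs : K -> R) (p : nat).
Hypotheses (p_pr : prime p) (absP : padic_abs abs p).
Implicit Types (x y z t u : K) (a : nat -> K) (B : R).

Let p_gt0 : (0 < p)%N. Proof. exact: prime_gt0. Qed.

Lemma abs_ge0 x : 0 <= abs x. Proof. by case: absP => + _ _ _ _; apply. Qed.
Lemma abs0P x : abs x = 0 <-> x = 0. Proof. by case: absP => _ + _ _ _; apply. Qed.
Lemma absM x y : abs (x * y) = abs x * abs y.
Proof. by case: absP => _ _ + _ _; apply. Qed.
Lemma abs_add x y : abs (x + y) <= Num.max (abs x) (abs y).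
Proof. by case: absP => _ _ _ + _; apply. Qed.
Lemma abs_nat n : (0 < n)%N -> abs n%:R = p%:R ^- logn p n.
Proof. by case: absP => _ _ _ _; apply. Qed.

Lemma abs0 : abs 0 = 0. Proof. exact/abs0P. Qed.
Lemma abs1 : abs 1 = 1.
Proof. by rewrite -[1]/(1%:R) abs_nat // logn1 expr0 invr1. Qed.

Lemma abs_eq0 x : (abs x == 0) = (x == 0).
Proof. by apply/eqP/eqP => /abs0P. Qed.

Lemma abs_gt0 x : (0 < abs x) = (x != 0).
Proof. by rewrite lt0r abs_eq0 abs_ge0 andbT. Qed.

Lemma absN1 : abs (-1) = 1.
Proof.
apply/eqP; rewrite -(@eqrXn2 _ 2) ?ler01 ?abs_ge0 // expr1n expr2 -absM mulrNN mulr1.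
by rewrite abs1.
Qed.

Lemma absN x : abs (- x) = abs x.
Proof. by rewrite -mulN1r absM absN1 mul1r. Qed.

Lemma absX x n : abs (x ^+ n) = abs x ^+ n.
Proof. by elim: n => [|n IHn]; rewrite ?expr0 ?abs1 // !exprS absM IHn. Qed.

Lemma absV x : abs x^-1 = (abs x)^-1.
Proof.
have [->|x_neq0] := eqVneq x 0; first by rewrite invr0 abs0 invr0.
by apply: (mulIf (x := abs x)); rewrite ?abs_eq0 // mulVf ?abs_eq0 // -absM mulVf // abs1.
Qed.

Lemma absB x y : abs (x - y) = abs (y - x).
Proof. by rewrite -absN opprB. Qed.

Lemma abs_add_le x y B : abs x <= B -> abs y <= B -> abs (x + y) <= B.
Proof. by move=> xB yB; apply: le_trans (abs_add x y) _; rewrite ge_max xB. Qed.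

Lemma abs_add_lt x y B : abs x < B -> abs y < B -> abs (x + y) < B.
Proof. by move=> xB yB; apply: le_lt_trans (abs_add x y) _; rewrite gt_max xB. Qed.

Lemma abs_dist_le y x z B : abs (x - y) <= B -> abs (y - z) <= B -> abs (x - z) <= B.
Proof. by move=> xy yz; rewrite -[x](subrK y) -addrA; apply: abs_add_le. Qed.

Lemma abs_dist_lt y x z B : abs (x - y) < B -> abs (y - z) < B -> abs (x - z) < B.
Proof. by move=> xy yz; rewrite -[x](subrK y) -addrA; apply: abs_add_lt. Qed.

(** Otherwise [x = (x + y) - y] would be a sum of two elements smaller than [x]. *)
Lemma abs_addl x y : abs y < abs x -> abs (x + y) = abs x.
Proof.
move=> yx; apply/eqP; rewrite eq_le abs_add_le ?(ltW yx) //= leNgt; apply/negP => xyx.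
have := abs_add_lt (B := abs x) xyx (_ : abs (- y) < abs x).
by rewrite absN addrK ltxx => /(_ yx).
Qed.

Lemma abs_sum_le (I : Type) (r : seq I) (P : pred I) (F : I -> K) B :
  0 <= B -> (forall i, P i -> abs (F i) <= B) -> abs (\sum_(i <- r | P i) F i) <= B.
Proof.
move=> B_ge0 FB; apply: (big_ind (fun x => abs x <= B)) => //; first by rewrite abs0.
by move=> x y; apply: abs_add_le.
Qed.

Lemma abs_nat_le1 n : abs n%:R <= 1.
Proof.
case: n => [|n]; first by rewrite abs0 ler01.
by rewrite abs_nat // invf_le1 ?exprn_gt0 ?ltr0n // exprn_ege1 // ler1n.
Qed.

Lemma abs_int_le1 (z : int) : abs z%:~R <= 1.
Proof.
by case: z => n; rewrite ?NegzE ?mulrNz ?absN -pmulrn abs_nat_le1.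
Qed.

Lemma abs_p : abs p%:R = p%:R^-1.
Proof. by rewrite abs_nat // logn_prime // eqxx expr1. Qed.

Lemma natf_neq0 n : (0 < n)%N -> n%:R != 0 :> K.
Proof. by move=> n_gt0; rewrite -abs_gt0 abs_nat // invr_gt0 exprn_gt0 // ltr0n. Qed.

Lemma abs_nat_coprime n : coprime p n -> abs n%:R = 1.
Proof.
case: n => [|n]; first by rewrite /coprime gcdn0 => /eqP p1;
  have := prime_gt1 p_pr; rewrite p1.
by move=> pn; rewrite abs_nat // logn_coprime // expr0 invr1.
Qed.

(** An integer that is not a unit is divisible by [p]. *)
Lemma abs_int_lt1 (z : int) : abs z%:~R < 1 -> abs z%:~R <= p%:R^-1.
Proof.
have abs_n n : abs n%:R < 1 -> abs n%:R <= p%:R^-1.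
  move=> n_lt1; have pn : (p %| n)%N.
    rewrite -[X in is_true X]negbK -prime_coprime //.
    by apply: contraTN n_lt1 => /abs_nat_coprime ->; rewrite ltxx.
  rewrite -(divnK pn) natrM absM abs_p; apply: ler_piMl (abs_nat_le1 _).
  by rewrite invr_ge0 ler0n.
by case: z => n; rewrite ?NegzE ?mulrNz ?absN -pmulrn => /abs_n.
Qed.

(** * Limits and series *)

Lemma cvg_to_dist_le (u : nat -> K) (l c : K) B N :
  cvg_to abs u l -> (forall n, (N <= n)%N -> abs (u n - c) <= B) -> abs (l - c) <= B.
Proof.
move=> ul ucB; rewrite leNgt; apply/negP => Blc.
have lc_gt0 : 0 < abs (l - c).
  by apply: le_lt_trans Blc; apply: le_trans (abs_ge0 _) (ucB N (leqnn N)).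
(* A late term would lie closer than [abs (l - c)] to both [l] and [c]. *)
have [M uM] := ul _ lc_gt0.
have := @abs_dist_lt (u (maxn N M)) l c (abs (l - c)).
by rewrite ltxx absB uM ?leq_maxr // (le_lt_trans (ucB _ _) Blc) ?leq_maxl // => /(_ isT isT).
Qed.

Lemma cvg_to_unique (u : nat -> K) (l l' : K) :
  cvg_to abs u l -> cvg_to abs u l' -> l = l'.
Proof.
move=> ul ul'; apply/subr0_eq/abs0P/eqP; rewrite eq_le abs_ge0 andbT leNgt.
apply/negP => d_gt0; have [N uN] := ul' _ d_gt0; have [M uM] := ul _ d_gt0.
have := @abs_dist_lt (u (maxn N M)) l l' (abs (l - l')).
by rewrite ltxx absB uM ?leq_maxr // uN ?leq_maxl // => /(_ isT isT).
Qed.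

Lemma cvg_to_lincomb (u v : nat -> K) (l l' c d : K) :
  cvg_to abs u l -> cvg_to abs v l' ->
  cvg_to abs (fun n => c * u n + d * v n) (c * l + d * l').
Proof.
have scale (w : nat -> K) (m e : K) : cvg_to abs w m -> cvg_to abs (fun n => e * w n) (e * m).
  move=> wm eps eps_gt0; have [->|e_neq0] := eqVneq e 0.
    by exists 0%N => n _; rewrite !mul0r subrr abs0.
  have e_gt0 : 0 < abs e by rewrite abs_gt0.
  have [N wN] := wm _ (divr_gt0 eps_gt0 e_gt0); exists N => n Nn.
  by rewrite -mulrBr absM mulrC -ltr_pdivlMr // wN.
move=> ul vl' eps eps_gt0.
have [N uN] := scale u l c ul _ eps_gt0; have [M vM] := scale v l' d vl' _ eps_gt0.
exists (maxn N M) => n; rewrite geq_max => /andP[Nn Mn].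
by rewrite opprD addrACA; apply: abs_add_lt; [apply: uN | apply: vM].
Qed.

(** The ultrametric inequality bounds a tail as soon as it bounds each term; the estimates of exp
    and log by their first terms come from here. *)
Lemma series_to_tail_le a (l : K) B N :
  0 <= B -> series_to abs a l -> (forall m, (N <= m)%N -> abs (a m) <= B) ->
  abs (l - \sum_(m < N) a m) <= B.
Proof.
move=> B_ge0 al aB; apply: (cvg_to_dist_le al (N := N)) => n Nn.
rewrite -!(big_mkord xpredT a) (big_cat_nat (leq0n N) Nn) //= addrAC subrr add0r big_nat_cond.
by apply: abs_sum_le => // i /andP[/andP[Ni _] _]; apply: aB.
Qed.

(** * Teichmüller representatives *)

Lemma eq0_of_abs_le_expr (b : R) x :
  0 <= b -> b < 1 -> (forall n, abs x <= b ^+ n) -> x = 0.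
Proof.
move=> b_ge0 b_lt1 xb; apply/abs0P/eqP; rewrite eq_le abs_ge0 andbT leNgt.
by apply/negP => /(geometric_lt b_ge0 b_lt1)[n]; rewrite ltNge xb.
Qed.

Lemma abs_congr1 x y : abs y = 1 -> abs (x - y) < 1 -> abs x = 1.
Proof. by move=> y1 xy; rewrite -[x](subrKC y) abs_addl y1. Qed.

Lemma abs_exprB_le x y n :
  abs x <= 1 -> abs y <= 1 -> abs (x ^+ n - y ^+ n) <= abs (x - y).
Proof.
move=> x1 y1; rewrite subrXX absM ler_piMr ?abs_ge0 //.
by apply: abs_sum_le => // i _; rewrite absM !absX mulr_ile1 ?exprn_ge0 ?exprn_ile1 ?abs_ge0.
Qed.

Lemma abs_expr_sub1_le u n : abs u = 1 -> abs (u ^+ n - 1) <= abs (u - 1).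
Proof. by move=> u1; have := @abs_exprB_le u 1 n; rewrite expr1n u1 abs1; apply. Qed.

(** The cofactor [1 + u + ... + u ^ (n - 1)] is congruent to [n], which is a unit. *)
Lemma abs_expr_coprime_sub1 u n :
  abs (u - 1) < 1 -> coprime p n -> abs (u ^+ n - 1) = abs (u - 1).
Proof.
move=> u1 pn; have abs_u := abs_congr1 abs1 u1; rewrite subrX1 absM.
suff -> : abs (\sum_(i < n) u ^+ i) = 1 by rewrite mulr1.
apply: abs_congr1 (abs_nat_coprime pn) _.
rewrite -[n in n%:R]card_ord -sumr_const -sumrB.
apply: le_lt_trans u1; apply: abs_sum_le (abs_ge0 _) _ => i _.
exact: abs_expr_sub1_le.
Qed.

(** Each [p]-th power gains a factor [b]: the new cofactor is congruent to [p] up to [b], and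
    [abs p <= b]. *)
Lemma abs_expr_pX_sub1 u b n : abs (u - 1) <= b -> p%:R^-1 <= b -> b < 1 ->
  abs (u ^+ (p ^ n) - 1) <= b ^+ n.
Proof.
move=> ub pb b1; have abs_u := abs_congr1 abs1 (le_lt_trans ub b1).
have b_ge0 : 0 <= b by apply: le_trans ub; apply: abs_ge0.
elim: n => [|n IHn]; first by rewrite expn0 expr1 expr0 (le_trans ub) ?ltW.
rewrite expnSr exprM subrX1 absM exprSr; apply: ler_pM; rewrite ?abs_ge0 //.
rewrite -[X in abs X](subrK p%:R); apply: abs_add_le; last by rewrite abs_p.
rewrite -[p in p%:R]card_ord -sumr_const -sumrB.
apply: abs_sum_le b_ge0 _ => i _; apply: le_trans ub.
by rewrite -exprM abs_expr_sub1_le.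
Qed.

Lemma residue_card_gt1 q : residue_card abs q -> (1 < q)%N.
Proof.
case=> r [_ _ _ r_cover].
have [|j jq j0] := r_cover 0; first by rewrite abs0 ler01.
have [|k kq k1] := r_cover 1; first by rewrite abs1.
rewrite ltnNge; apply/negP => q1; have jk : j = k by lia.
rewrite -jk in k1; rewrite absB in j0.
by have := abs_dist_lt k1 j0; rewrite subr0 abs1 ltxx.
Qed.

(* Multiplication by [x] permutes the nonzero residue classes. *)
Lemma residue_fermat q x :
  residue_card abs q -> abs x = 1 -> abs (x ^+ q.-1 - 1) < 1.
Proof.
case=> r [_ r_le1 r_sep r_cover] x1.
have [|j jq j0P] := r_cover 0; first by rewrite abs0 ler01.
pose j0 : 'I_q := Ordinal jq.
have rj0 : abs r`_j0 < 1 by rewrite -absN -sub0r.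
have eq_class (k l : 'I_q) : abs (r`_k - r`_l) < 1 -> k = l.
  move=> kl; apply/eqP; apply: contraTT kl => /eqP kl; rewrite -leNgt.
  by apply: r_sep => // /val_inj.
have r_unit (k : 'I_q) : k != j0 -> abs r`_k = 1.
  move=> kj; apply/eqP; rewrite eq_le r_le1 //= leNgt; apply: contraNN kj => rk.
  by apply/eqP/eq_class; apply: abs_add_lt; rewrite ?absN.
(* [sg k] is the class of [x] times the [k]-th representative. The default [k] never occurs, since
   the representatives cover the unit ball. *)
pose sg (k : 'I_q) := odflt k [pick l : 'I_q | abs (x * r`_k - r`_l) < 1].
have sgP (k : 'I_q) : abs (x * r`_k - r`_(sg k)) < 1.
  rewrite /sg; case: pickP => //= no_class.
  have [|l lq] := r_cover (x * r`_k); first by rewrite absM x1 mul1r r_le1.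
  by have := no_class (Ordinal lq) => /= ->.
have sg_inj : injective sg.
  move=> k l kl; apply: eq_class.
  suff: abs (x * (r`_k - r`_l)) < 1 by rewrite absM x1 mul1r.
  by rewrite mulrBr; apply: abs_dist_lt (sgP k) _; rewrite absB kl.
have sg_j0 : sg j0 = j0.
  apply/eqP; apply: contraLR (sgP j0) => /r_unit sg1; rewrite -leNgt absB.
  by rewrite abs_addl ?sg1 // absN absM x1 mul1r.
pose Pr := \prod_(k < q | k != j0) r`_k.
have Pr1 : abs Pr = 1.
  rewrite /Pr; apply: (big_ind (fun y => abs y = 1)) => //; first exact: abs1.
  by move=> y z y1 z1; rewrite absM y1 z1 mulr1.
have PrE : Pr = \prod_(k < q | k != j0) r`_(sg k).
  rewrite /Pr (reindex_inj sg_inj); apply: eq_bigl => k.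
  by rewrite -[in LHS]sg_j0 (inj_eq sg_inj).
have xPr : \prod_(k < q | k != j0) (x * r`_k) = x ^+ q.-1 * Pr.
  rewrite big_split prodr_const /=; congr (_ ^+ _ * _).
  by rewrite cardC1 card_ord.
suff: abs (x ^+ q.-1 * Pr - Pr) < 1.
  by rewrite -{2}[Pr]mul1r -mulrBl absM Pr1 mulr1.
rewrite -xPr {Pr1 xPr}PrE.
(* The bounds by 1 are carried along so that congruences can be multiplied. *)
pose near y z := [/\ abs y <= 1, abs z <= 1 & abs (y - z) < 1].
suff: near (\prod_(k < q | k != j0) (x * r`_k)) (\prod_(k < q | k != j0) r`_(sg k)).
  by case.
apply: (big_ind2 near); first by split; rewrite ?abs1 // subrr abs0 ltr01.
- move=> y z y' z' [y1 z1 yz] [y'1 z'1 yz'].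
  split; rewrite ?absM ?mulr_ile1 ?abs_ge0 //.
  have -> : y * y' - z * z' = (y - z) * y' + z * (y' - z') by ring.
  apply: abs_add_lt; rewrite absM.
    by apply: le_lt_trans yz; rewrite ler_piMr ?abs_ge0.
  by apply: le_lt_trans yz'; rewrite ler_piMl ?abs_ge0.
- by move=> k _; split => //; rewrite ?absM ?x1 ?mul1r r_le1.
Qed.

Hypothesis abs_complete : complete_abs abs.

(** The representative is the limit of [x ^ (q ^ n)]. Consecutive terms have ratio [y ^ (q ^ n)]
    with [y = x ^ (q - 1)], which tends to 1 geometrically because [y] is congruent to 1. *)
Lemma teichmuller_exists f x : residue_card abs (p ^ f) -> abs x = 1 ->
  exists w, w ^+ (p ^ f).-1 = 1 /\ abs (w - x) < 1.
Proof.
move=> resq x1; set q := (p ^ f)%N; have q_gt1 := residue_card_gt1 resq.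
have f_gt0 : (0 < f)%N by case: (f) q_gt1.
pose y := x ^+ q.-1; have y1 : abs (y - 1) < 1 by apply: residue_fermat.
pose b := Num.max (abs (y - 1)) p%:R^-1.
have b_lt1 : b < 1 by rewrite gt_max y1 invf_lt1 ?ltr0n ?ltr1n ?prime_gt1.
have b_ge0 : 0 <= b by rewrite le_max abs_ge0.
have yX n : abs (y ^+ (q ^ n) - 1) <= b ^+ n.
  rewrite -expnM; apply: le_trans (abs_expr_pX_sub1 (b := b) _ _ _ _) _ => //.
  - by rewrite le_max lexx.
  - by rewrite le_max lexx orbT.
  by apply: ler_wiXn2l; rewrite ?(ltW b_lt1) // leq_pmull.
pose w n := x ^+ (q ^ n).
have wS n : w n.+1 - w n = w n * (y ^+ (q ^ n) - 1).
  rewrite /w /y mulrBr mulr1 -exprM -exprD -mulSn prednK ?expnS //.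
  exact: ltnW.
have w1 n : abs (w n) = 1 by rewrite absX x1 expr1n.
have dist n k B : 0 <= B -> (forall m, (n <= m)%N -> abs (y ^+ (q ^ m) - 1) <= B) ->
    abs (w (n + k)%N - w n) <= B.
  move=> B_ge0 yB; elim: k => [|k IHk]; first by rewrite addn0 subrr abs0.
  apply: abs_dist_le IHk; rewrite addnS wS absM w1 mul1r yB //.
  exact: leq_addr.
have dist_b n k : abs (w (n + k)%N - w n) <= b ^+ n.
  apply: dist; first exact: exprn_ge0.
  by move=> m nm; apply: le_trans (yX m) _; apply: ler_wiXn2l; rewrite ?(ltW b_lt1).
have [|l wl] := abs_complete (u := w).
  move=> eps eps_gt0; have [N bN] := geometric_lt b_ge0 b_lt1 eps_gt0.
  exists N => m n /subnKC <- /subnKC <-; apply: (abs_dist_lt (y := w N)).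
    exact: le_lt_trans bN.
  by rewrite absB; apply: le_lt_trans bN.
have lx : abs (l - x) < 1.
  apply: (le_lt_trans _ y1); apply: (cvg_to_dist_le wl (N := 0)) => n _.
  have := dist 0%N n (abs (y - 1)) (abs_ge0 _); rewrite add0n /w expn0 expr1.
  by apply=> m _; apply: abs_expr_sub1_le; apply: abs_congr1 abs1 y1.
exists l; split => //; apply/subr0_eq.
apply: (eq0_of_abs_le_expr b_ge0 b_lt1) => n.
(* [w n ^+ q.-1] equals [y ^+ (q ^ n)], which is within [b ^+ n] of 1. *)
apply: (abs_dist_le (y := w n ^+ q.-1)); last first.
  by rewrite /w -exprM mulnC exprM.
apply: le_trans (abs_exprB_le _ _ _) _; rewrite ?w1 ?(abs_congr1 x1 lx) //.
by apply: (cvg_to_dist_le wl (N := n)) => m /subnKC <-.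
Qed.

Lemma omegaP f x : residue_card abs (p ^ f) -> abs x = 1 ->
  omega abs (p ^ f) x ^+ (p ^ f).-1 = 1 /\ abs (omega abs (p ^ f) x - x) < 1.
Proof.
by move=> resq x1; exact: (epsilon_spec (inhabits 0) _ (teichmuller_exists resq x1)).
Qed.

Lemma coprime_predX f : (1 < p ^ f)%N -> coprime p (p ^ f).-1.
Proof.
move=> q_gt1; have := coprimenP (ltnW q_gt1).
by rewrite coprime_pexpl //; case: (f) q_gt1.
Qed.

(** The quotient [v] of two candidates is congruent to 1 and [v ^ (q - 1) = 1]; as [q - 1] is prime
    to [p], [abs (v - 1) = abs (v ^ (q - 1) - 1) = 0]. *)
Lemma omega_unique f x w : residue_card abs (p ^ f) -> abs x = 1 ->
  w ^+ (p ^ f).-1 = 1 -> abs (w - x) < 1 -> omega abs (p ^ f) x = w.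
Proof.
move=> resq x1 wq wx; have [oq ox] := omegaP resq x1.
have w1 := abs_congr1 x1 wx; have w_neq0 : w != 0 by rewrite -abs_gt0 w1 ltr01.
set o := omega _ _ _ in oq ox *.
have vE : o / w - 1 = (o - w) / w by field.
have v1 : abs (o / w - 1) < 1.
  by rewrite vE absM absV w1 invr1 mulr1; apply: abs_dist_lt ox _; rewrite absB.
have := abs_expr_coprime_sub1 v1 (coprime_predX (residue_card_gt1 resq)).
rewrite expr_div_n oq wq divr1 subrr abs0 vE => /esym/abs0P/eqP.
by rewrite mulf_eq0 invr_eq0 (negbTE w_neq0) orbF subr_eq0 => /eqP.
Qed.

(** * The exponential series *)

Variable s : R.
Hypotheses (s_gt0 : 0 < s) (s_lt1 : s < 1) (sE : s ^+ p.-1 = p%:R^-1).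

Let s_ge0 : 0 <= s. Proof. exact: ltW. Qed.
Let s_le1 : s <= 1. Proof. exact: ltW. Qed.
Let sX_ge0 n : 0 <= s ^+ n. Proof. exact: exprn_ge0. Qed.
Let sX_gt0 n : 0 < s ^+ n. Proof. exact: exprn_gt0. Qed.
Let sX_le1 n : s ^+ n <= 1. Proof. exact: exprn_ile1. Qed.
Let sX_le m n : (m <= n)%N -> s ^+ n <= s ^+ m.
Proof. exact: ler_wiXn2l. Qed.

Lemma abs_nat_ge n : s ^+ n <= abs n.+1%:R.
Proof. by rewrite abs_nat // -exprVn -sE -exprM sX_le // logn_lt. Qed.

Lemma abs_fact_ge n : s ^+ n <= abs n`!%:R.
Proof. by rewrite abs_nat ?fact_gt0 // -exprVn -sE -exprM sX_le // logn_fact_le. Qed.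

Lemma geometric_series_cvg a :
  (forall m, abs (a m) <= s ^+ m) -> exists l, series_to abs a l.
Proof.
move=> a_le; apply: abs_complete => eps eps_gt0.
have [N sN] := geometric_lt s_ge0 s_lt1 eps_gt0.
have tail n : (N <= n)%N -> abs (\sum_(m < n) a m - \sum_(m < N) a m) < eps.
  move=> Nn; apply: le_lt_trans sN.
  rewrite -!(big_mkord xpredT a) (big_cat_nat (leq0n N) Nn) //=.
  rewrite addrAC subrr add0r big_nat_cond.
  apply: abs_sum_le => // i /andP[/andP[Ni _] _]; exact: le_trans (a_le i) (sX_le Ni).
exists N => m n Nm Nn; apply: (abs_dist_lt (tail m Nm)).
by rewrite absB tail.
Qed.

Lemma geometric_partial_le1 a n :
  (forall m, abs (a m) <= s ^+ m) -> abs (\sum_(m < n) a m) <= 1.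
Proof. by move=> a_le; apply: abs_sum_le => // i _; apply: le_trans (a_le i) _. Qed.

Lemma geometric_series_le1 a l :
  (forall m, abs (a m) <= s ^+ m) -> series_to abs a l -> abs l <= 1.
Proof.
move=> a_le al; rewrite -[l]subr0 -(big_ord0 0 +%R xpredT (fun i : 'I_0 => a i)).
by apply: series_to_tail_le => // m _; apply: le_trans (a_le m) _.
Qed.

(* The product of the two truncations is the value at 1 of a polynomial whose
   coefficients of degree below [n] are those of the Cauchy product. *)
Lemma cauchy_product_partial a b n :
  (forall m, abs (a m) <= s ^+ m) -> (forall m, abs (b m) <= s ^+ m) ->
  abs (\sum_(m < n) \sum_(i < m.+1) a i * b (m - i)%N
         - (\sum_(m < n) a m) * (\sum_(m < n) b m)) <= s ^+ n.
Proof.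
move=> a_le b_le; pose P := \poly_(i < n) a i; pose Q := \poly_(i < n) b i.
have sumE (c : nat -> K) : \sum_(m < n) c m = (\poly_(i < n) c i).[1].
  by rewrite horner_poly; apply: eq_bigr => i _; rewrite expr1n mulr1.
have coef_le (c : nat -> K) i : (forall m, abs (c m) <= s ^+ m) ->
    abs (\poly_(i < n) c i)`_i <= s ^+ i.
  by move=> c_le; rewrite coef_poly; case: ifP => // _; rewrite abs0.
rewrite (sumE a) (sumE b) -hornerM -/P -/Q.
rewrite (@horner_coef_wide _ (n + n)); last first.
  apply: leq_trans (size_polyMleq _ _) _.
  exact: leq_trans (leq_pred _) (leq_add (size_poly _ _) (size_poly _ _)).
rewrite big_split_ord /= opprD addrA -sumrB big1 ?add0r => [|m _]; last first.
  rewrite expr1n mulr1 coefM; apply/eqP; rewrite subr_eq0; apply/eqP/eq_bigr => i _.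
  by rewrite !coef_poly !ifT //; have := ltn_ord i; have := ltn_ord m; lia.
(* Here [m] stands for degree [n + m], so every product of coefficients is at most
   [s ^+ (n + m)]. *)
rewrite absN; apply: abs_sum_le => // m _; rewrite expr1n mulr1 coefM.
apply: abs_sum_le => // i _; rewrite absM.
apply: le_trans (_ : s ^+ i * s ^+ (n + m - i) <= _).
  by apply: ler_pM; rewrite ?abs_ge0 ?coef_le.
by rewrite -exprD sX_le //; have := ltn_ord i; lia.
Qed.

(** The truncated product and the two tails each contribute an error of at most [s ^+ n]. *)
Lemma cauchy_product_cvg a b la lb :
  (forall m, abs (a m) <= s ^+ m) -> (forall m, abs (b m) <= s ^+ m) ->
  series_to abs a la -> series_to abs b lb ->
  series_to abs (fun m => \sum_(i < m.+1) a i * b (m - i)%N) (la * lb).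
Proof.
move=> a_le b_le ala blb eps eps_gt0.
have [N sN] := geometric_lt s_ge0 s_lt1 eps_gt0; exists N => n Nn.
apply: le_lt_trans sN; apply: le_trans (sX_le Nn).
have tail c l : (forall m, abs (c m) <= s ^+ m) -> series_to abs c l ->
    abs (\sum_(m < n) c m - l) <= s ^+ n.
  move=> c_le cl; rewrite absB; apply: series_to_tail_le => // m nm.
  exact: le_trans (c_le m) (sX_le nm).
apply: abs_dist_le (cauchy_product_partial n a_le b_le) _.
set A := \sum_(m < n) a m; set B := \sum_(m < n) b m.
have -> : A * B - la * lb = (A - la) * B + la * (B - lb) by ring.
apply: abs_add_le; rewrite absM.
  by rewrite -[leRHS]mulr1; apply: ler_pM; rewrite ?abs_ge0 ?tail ?geometric_partial_le1.
rewrite -[leRHS]mul1r; apply: ler_pM; rewrite ?abs_ge0 ?tail //.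
exact: geometric_series_le1 ala.
Qed.

Definition exp_term x m := x ^+ m / m`!%:R.

Definition pexp x : K := epsilon (inhabits 0) (series_to abs (exp_term x)).

(** Half of [s ^ (2 m)] absorbs the denominator [m!], and the other half leaves geometric decay;
    hence the choice of the radius [s ^+ 2]. *)
Lemma abs_exp_term x m : abs x <= s ^+ 2 -> abs (exp_term x m) <= s ^+ m.
Proof.
move=> xs; rewrite /exp_term absM absX absV ler_pdivrMr; last first.
  exact: lt_le_trans (sX_gt0 m) (abs_fact_ge m).
apply: le_trans (_ : s ^+ m * s ^+ m <= _); last by rewrite ler_wpM2l // abs_fact_ge.
by rewrite -exprD addnn -mul2n exprM; apply: lerXn2r; rewrite ?qualifE /= ?abs_ge0.
Qed.

Lemma pexpP x : abs x <= s ^+ 2 -> series_to abs (exp_term x) (pexp x).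
Proof.
move=> xs; apply: epsilon_spec; apply: geometric_series_cvg => m; exact: abs_exp_term.
Qed.

Lemma abs_pexp_le1 x : abs x <= s ^+ 2 -> abs (pexp x) <= 1.
Proof.
move=> xs; apply: geometric_series_le1 (pexpP xs) => m; exact: abs_exp_term.
Qed.

Lemma pexp0 : pexp 0 = 1.
Proof.
have s0 : abs 0 <= s ^+ 2 by rewrite abs0.
apply: (cvg_to_unique (pexpP s0)) => eps eps_gt0; exists 1%N => -[|n] // _.
rewrite big_ord_recl big1 => [|i _]; last by rewrite /exp_term expr0n mul0r.
by rewrite /exp_term expr0 fact0 divr1 addr0 subrr abs0.
Qed.

Lemma exp_termD x y m :
  exp_term (x + y) m = \sum_(i < m.+1) exp_term x i * exp_term y (m - i)%N.
Proof.
rewrite /exp_term [x + y]addrC exprDn mulr_suml; apply: eq_bigr => i _.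
have im : (i <= m)%N by rewrite -ltnS.
have := natf_neq0 (fact_gt0 m); rewrite -(bin_fact im) !natrM => nz.
rewrite -[_ *+ _]mulr_natr; field.
by move: nz; rewrite !mulf_eq0 !negb_or => /andP[-> /andP[-> ->]].
Qed.

Lemma pexpD x y :
  abs x <= s ^+ 2 -> abs y <= s ^+ 2 -> pexp (x + y) = pexp x * pexp y.
Proof.
move=> xs ys; apply: cvg_to_unique (pexpP (abs_add_le xs ys)) _.
have := cauchy_product_cvg (fun m => abs_exp_term m xs) (fun m => abs_exp_term m ys)
  (pexpP xs) (pexpP ys).
move=> xy eps /xy[N HN]; exists N => n /HN.
by under eq_bigr do rewrite -exp_termD.
Qed.

Lemma abs_scale_le c x : abs c <= 1 -> abs x <= s ^+ 2 -> abs (c * x) <= s ^+ 2.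
Proof. by move=> c1 xs; rewrite absM -[leRHS]mul1r ler_pM ?abs_ge0. Qed.

Lemma pexp_natM n x : abs x <= s ^+ 2 -> pexp (n%:R * x) = pexp x ^+ n.
Proof.
move=> xs; elim: n => [|n IHn]; first by rewrite mul0r pexp0.
rewrite -natr1 mulrDl mul1r pexpD //; first by rewrite IHn exprSr.
exact: abs_scale_le (abs_nat_le1 n) xs.
Qed.

Lemma pexpN x : abs x <= s ^+ 2 -> pexp x * pexp (- x) = 1.
Proof. by move=> xs; rewrite -pexpD ?absN // subrr pexp0. Qed.

(** Both [pexp x] and its inverse [pexp (- x)] are integral. *)
Lemma abs_pexp x : abs x <= s ^+ 2 -> abs (pexp x) = 1.
Proof.
move=> xs; apply/eqP; rewrite eq_le abs_pexp_le1 //= -(abs1) -(pexpN xs) absM.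
by rewrite ler_piMr ?abs_ge0 // abs_pexp_le1 // absN.
Qed.

Lemma abs_exp_term_scale c x m : abs x <= s ^+ 2 ->
  abs (exp_term (c * x) m) <= abs c ^+ m * s ^+ m.
Proof.
move=> xs; rewrite /exp_term exprMn -mulrA absM absX ler_wpM2l ?exprn_ge0 ?abs_ge0 //.
exact: abs_exp_term.
Qed.

Lemma abs_pexp_scale_sub1 c x :
  abs c <= 1 -> abs x <= s ^+ 2 -> abs (pexp (c * x) - 1) <= abs c.
Proof.
move=> c1 xs; have -> : 1 = \sum_(m < 1) exp_term (c * x) m.
  by rewrite big_ord1 /exp_term expr0 fact0 divr1.
apply: series_to_tail_le (abs_ge0 _) (pexpP (abs_scale_le c1 xs)) _ => m m_gt0.
apply: le_trans (abs_exp_term_scale c m xs) _; rewrite -[leRHS]mulr1.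
apply: ler_pM; rewrite ?exprn_ge0 ?abs_ge0 // -[leRHS]expr1.
exact: ler_wiXn2l (abs_ge0 _) c1 _ _ m_gt0.
Qed.

(** The error is quadratic in [c], as in [plog_approx]; together they compare the [n]-th powers of
    [exp (log u)] and [u]. *)
Lemma abs_pexp_scale_sub2 c x :
  abs c <= 1 -> abs x <= s ^+ 2 -> abs (pexp (c * x) - (1 + c * x)) <= abs c ^+ 2.
Proof.
move=> c1 xs; have -> : 1 + c * x = \sum_(m < 2) exp_term (c * x) m.
  by rewrite big_ord_recr big_ord1 /exp_term /= expr0 fact0 divr1 expr1 divr1.
apply: series_to_tail_le (exprn_ge0 _ (abs_ge0 _)) (pexpP (abs_scale_le c1 xs)) _ => m m_gt1.
apply: le_trans (abs_exp_term_scale c m xs) _; rewrite -[leRHS]mulr1.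
apply: ler_pM; rewrite ?exprn_ge0 ?abs_ge0 //.
exact: ler_wiXn2l (abs_ge0 _) c1 _ _ m_gt1.
Qed.

Lemma abs_pexp_sub1 x : abs x <= s ^+ 2 -> abs (pexp x - 1) <= s ^+ 2.
Proof.
move=> xs; have -> : 1 = \sum_(m < 1) exp_term x m.
  by rewrite big_ord1 /exp_term expr0 fact0 divr1.
apply: series_to_tail_le (pexpP xs) _ => // -[|[|m]] // _.
  by rewrite /exp_term expr1 divr1.
exact: le_trans (abs_exp_term _ xs) (sX_le _).
Qed.

(** [exp (y x) - exp (z x) = exp (z x) (exp ((y - z) x) - 1)], and the first factor is a unit. *)
Lemma pexp_lipschitz x y z : abs x <= s ^+ 2 -> abs y <= 1 -> abs z <= 1 ->
  abs (pexp (y * x) - pexp (z * x)) <= abs (y - z).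
Proof.
move=> xs y1 z1; have yz1 : abs (y - z) <= 1 by apply: abs_add_le; rewrite ?absN.
have -> : y * x = (y - z) * x + z * x by ring.
rewrite pexpD ?abs_scale_le // -{2}[pexp (z * x)]mul1r -mulrBl absM.
by rewrite [X in _ * X]abs_pexp ?abs_scale_le // mulr1 abs_pexp_scale_sub1.
Qed.

(** * The logarithm series *)

Lemma abs_powS_div t k : abs t <= s ^+ 2 -> abs (t ^+ k.+1 / k.+1%:R) <= abs t * s ^+ k.
Proof.
move=> ts; rewrite absM absX absV ler_pdivrMr; last first.
  exact: lt_le_trans (sX_gt0 k) (abs_nat_ge k).
rewrite exprS -mulrA ler_wpM2l ?abs_ge0 //.
apply: le_trans (_ : s ^+ k * s ^+ k <= _); last by rewrite ler_wpM2l // abs_nat_ge.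
by rewrite -exprD addnn -mul2n exprM; apply: lerXn2r; rewrite ?qualifE /= ?abs_ge0.
Qed.

Lemma abs_plog_term u k : abs (u - 1) <= s ^+ 2 ->
  abs ((-1) ^+ k * (u - 1) ^+ k.+1 / k.+1%:R) <= s ^+ 2 * s ^+ k.
Proof.
move=> us; rewrite -mulrA absM absX absN1 expr1n mul1r.
by apply: le_trans (abs_powS_div k us) _; rewrite ler_wpM2r.
Qed.

Lemma plogP u : abs (u - 1) <= s ^+ 2 ->
  series_to abs (fun k => (-1) ^+ k * (u - 1) ^+ k.+1 / k.+1%:R) (plog abs u).
Proof.
move=> us; apply: epsilon_spec; apply: geometric_series_cvg => m.
by apply: le_trans (abs_plog_term m us) _; rewrite ler_piMl.
Qed.

Lemma abs_plog u : abs (u - 1) <= s ^+ 2 -> abs (plog abs u) <= s ^+ 2.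
Proof.
move=> us; have := series_to_tail_le (sX_ge0 2) (plogP us) (N := 0).
rewrite big_ord0 subr0; apply => m _.
by apply: le_trans (abs_plog_term m us) _; rewrite ler_piMr.
Qed.

(** From [(n + 1) C(n, m) = (m + 1) C(n + 1, m + 1)]. As [n + 1] tends to 0 p-adically, [C(n, m)]
    tends to [(-1) ^ m], so the sum approaches the series of [log (1 + t)]. *)
Lemma exprS_sub1E t n : (1 + t) ^+ n.+1 - 1 =
  n.+1%:R * \sum_(m < n.+1) 'C(n, m)%:R * (t ^+ m.+1 / m.+1%:R).
Proof.
rewrite exprDn big_ord_recl /= expr1n expr0 bin0 mulr1 mulr1n addrAC subrr add0r.
rewrite mulr_sumr; apply: eq_bigr => m _; rewrite /bump add1n expr1n mul1r.
have := congr1 (fun k => k%:R : K) (mul_bin_diag n.+1 m); rewrite !natrM /= => bin_eq.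
rewrite -mulr_natr mulrA bin_eq (mulrC m.+1%:R) -mulrA (mulrC m.+1%:R).
by rewrite divfK ?natf_neq0 // mulrC.
Qed.

(** In the expansion the term of index 0 is [t], and all others are at most [abs t * s]. *)
Lemma abs_exprS_sub1 t n : abs t <= s ^+ 2 ->
  abs ((1 + t) ^+ n.+1 - 1) = abs n.+1%:R * abs t.
Proof.
move=> ts; rewrite exprS_sub1E absM; congr (_ * _).
have [->|t_neq0] := eqVneq t 0.
  by rewrite big1 // => m _; rewrite expr0n mul0r mulr0.
rewrite big_ord_recl /= bin0 expr1 divr1 mul1r; apply: abs_addl.
apply: le_lt_trans (_ : abs t * s < _); last by rewrite gtr_pMr // abs_gt0.
apply: abs_sum_le => [|m _]; first by rewrite mulr_ge0 ?abs_ge0.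
rewrite absM; apply: le_trans (_ : 1 * (abs t * s ^+ (bump 0 m)) <= _).
  by apply: ler_pM; rewrite ?abs_ge0 ?abs_nat_le1 ?abs_powS_div.
by rewrite mul1r ler_wpM2l ?abs_ge0 // -[leRHS]expr1 sX_le.
Qed.

(** [(-1) ^ m] is [C(-1, m)]. Induction by Pascal's rule, with [C(n + 1, m + 1) = (n + 1) C(n, m) /
    (m + 1)]; the factor [s ^ m] pays for the denominators. *)
Lemma abs_bin_sub_sign n m :
  abs ('C(n, m)%:R - (-1) ^+ m) * s ^+ m <= abs n.+1%:R.
Proof.
elim: m => [|m IHm]; first by rewrite bin0 expr0 subrr abs0 mul0r abs_ge0.
have -> : 'C(n, m.+1)%:R - (-1) ^+ m.+1 =
    'C(n.+1, m.+1)%:R - ('C(n, m)%:R - (-1) ^+ m) :> K.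
  by rewrite binS natrD exprS; ring.
have absS c : abs c * s ^+ m.+1 <= abs n.+1%:R = (abs c <= abs n.+1%:R / s ^+ m.+1).
  by rewrite ler_pdivlMr.
rewrite absS; apply: abs_add_le; rewrite -?absS ?absN.
- have := congr1 (fun k => abs k%:R) (mul_bin_diag n.+1 m); rewrite !natrM /= !absM.
  move=> bin_eq; apply: le_trans (_ : abs m.+1%:R * abs 'C(n.+1, m.+1)%:R <= _).
    rewrite mulrC ler_wpM2r ?abs_ge0 //.
    exact: le_trans (sX_le (leqnSn m)) (abs_nat_ge m).
  by rewrite -bin_eq ler_piMr ?abs_ge0 ?abs_nat_le1.
- by apply: le_trans IHm; rewrite ler_wpM2l ?abs_ge0 // sX_le.
Qed.

(** After division by [n + 1], the expansion of the power and the log series are compared term by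
    term through [abs_bin_sub_sign]. *)
Lemma plog_approx u n : abs (u - 1) <= s ^+ 2 ->
  abs (u ^+ n.+1 - 1 - n.+1%:R * plog abs u) <= abs n.+1%:R ^+ 2.
Proof.
move=> us; rewrite -{1}[u](subrKC 1) exprS_sub1E -mulrBr absM expr2.
rewrite ler_wpM2l ?abs_ge0 // absB; apply: (cvg_to_dist_le (plogP us) (N := n.+1)) => N nN.
(* Binomials beyond [n] vanish, so the finite expansion may be extended to [N] terms. *)
rewrite (big_ord_widen _ (fun m => 'C(n, m)%:R * ((u - 1) ^+ m.+1 / m.+1%:R)) nN).
rewrite [X in _ - X]big_mkcond -sumrB /=; apply: abs_sum_le => [|m _]; first exact: abs_ge0.
have -> : (if (m < n.+1)%N then 'C(n, m)%:R * ((u - 1) ^+ m.+1 / m.+1%:R) else 0) =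
    'C(n, m)%:R * ((u - 1) ^+ m.+1 / m.+1%:R).
  by case: ifPn => //; rewrite -leqNgt => nm; rewrite bin_small // mul0r.
rewrite -mulrA -mulrBl absM absB.
apply: le_trans (abs_bin_sub_sign n m); rewrite ler_wpM2l ?abs_ge0 //.
by apply: le_trans (abs_powS_div m us) _; rewrite ler_piMl // (le_trans us).
Qed.

(* For [v = exp (log u) / u] and [n = p ^ k], both [exp (n log u)] and [u ^ n]
   agree with [1 + n log u] up to [|n|^2], while [|v ^ n - 1| = |n| |v - 1|];
   hence [|v - 1| <= |n|], which tends to 0. *)
Lemma pexp_plog u : abs (u - 1) <= s ^+ 2 -> pexp (plog abs u) = u.
Proof.
move=> us; have Ls := abs_plog us; set e := pexp (plog abs u).
have u1 : abs u = 1.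
  rewrite -[u](subrKC 1) abs_addl ?abs1 //; apply: le_lt_trans us _.
  by rewrite -[ltRHS](expr1n _ 2) ltrXn2r.
have u_neq0 : u != 0 by rewrite -abs_gt0 u1 ltr01.
have v_le : abs (e / u - 1) <= s ^+ 2.
  have -> : e / u - 1 = (e - u) / u by field.
  rewrite absM absV u1 invr1 mulr1; apply: (abs_dist_le (y := 1)).
    exact: abs_pexp_sub1.
  by rewrite absB.
suff: e / u - 1 = 0.
  by move/eqP; rewrite subr_eq0 => /eqP/(canRL (divfK u_neq0)); rewrite mul1r.
apply: (eq0_of_abs_le_expr s_ge0 s_lt1) => k.
have [n pk] : exists n, (p ^ k)%N = n.+1.
  by case: (p ^ k)%N (expn_gt0 p k) => [|n _]; [rewrite p_gt0 | exists n].
have n_gt0 : 0 < abs n.+1%:R by rewrite abs_gt0 natf_neq0.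
have n_le : abs n.+1%:R <= s ^+ k.
  rewrite -pk natrX absX abs_p -sE -exprM sX_le //.
  by rewrite leq_pmull // -subn1 subn_gt0 prime_gt1.
apply: le_trans n_le; rewrite -(ler_pM2l n_gt0) -abs_exprS_sub1 // subrKC -expr2.
have -> : (e / u) ^+ n.+1 - 1 = (e ^+ n.+1 - u ^+ n.+1) / u ^+ n.+1.
  by rewrite expr_div_n; field; exact: expf_neq0.
rewrite absM absV absX u1 expr1n invr1 mulr1 -pexp_natM //.
apply: (abs_dist_le (y := 1 + n.+1%:R * plog abs u)).
  exact: abs_pexp_scale_sub2 (abs_nat_le1 _) Ls.
by rewrite absB opprD addrA; apply: plog_approx.
Qed.

(** * The golden ratio *)

Section Golden.
Variable phi : K.
Hypotheses (p_neq2 : p != 2%N) (phiE : phi ^+ 2 - phi - 1 = 0).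

Lemma golden_exprS y n : y ^+ 2 - y - 1 = 0 ->
  y ^+ n.+1 = (fib n.+1)%:R * y + (fib n)%:R.
Proof.
move=> yE; have y2 : y ^+ 2 = y + 1 by apply/subr0_eq; rewrite -yE; ring.
elim: n => [|n IHn]; first by rewrite expr1 mul1r addr0.
have -> : fib n.+2 = (fib n.+1 + fib n)%N by [].
rewrite exprSr IHn natrD mulrDl -mulrA -expr2 y2; ring.
Qed.

Lemma golden_conjE : (1 - phi) ^+ 2 - (1 - phi) - 1 = 0.
Proof. by rewrite -phiE; ring. Qed.

Lemma binet n : phi ^+ n - (1 - phi) ^+ n = (fib n)%:R * (2 * phi - 1).
Proof.
case: n => [|n]; first by rewrite !expr0 subrr mul0r.
rewrite (golden_exprS n phiE) (golden_exprS n golden_conjE); ring.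
Qed.

(** If [abs y > 1], then [abs y ^ 2 = abs (y + 1) <= abs y], absurd; and [y (y - 1) = 1] forces
    [abs y >= 1]. *)
Lemma abs_golden y : y ^+ 2 - y - 1 = 0 -> abs y = 1.
Proof.
move=> yE; have y2 : y ^+ 2 = y + 1 by apply/subr0_eq; rewrite -yE; ring.
have y_le1 : abs y <= 1.
  rewrite leNgt; apply/negP => y_gt1.
  have := abs_add_le (lexx (abs y)) (y := 1); rewrite abs1 -y2 absX => /(_ (ltW y_gt1)).
  by rewrite expr2 ger_pMr ?(lt_trans ltr01) // leNgt y_gt1.
apply/eqP; rewrite eq_le y_le1 -abs1.
have -> : 1 = y * (y - 1) by apply/esym/subr0_eq; rewrite -yE; ring.
by rewrite absM ler_piMr ?abs_ge0 // abs_add_le ?absN ?abs1.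
Qed.

Lemma abs_sqrt5_sqr : abs (2 * phi - 1) ^+ 2 = abs 5%:R.
Proof.
rewrite -absX; congr abs; apply/subr0_eq.
have -> : (2 * phi - 1) ^+ 2 - 5%:R = 4 * (phi ^+ 2 - phi - 1) by ring.
by rewrite phiE mulr0.
Qed.

Lemma sqrt5_neq0 : 2 * phi - 1 != 0.
Proof.
have : abs (2 * phi - 1) ^+ 2 != 0 by rewrite abs_sqrt5_sqr abs_eq0 natf_neq0.
by apply: contraNneq => ->; rewrite abs0 expr0n.
Qed.

(* Unless [p = 5], the norm [(m + k phi) (m + k (1 - phi))] is an integer and the
   conjugate is a unit as soon as [k] is; for [p = 5], [2 (m + k phi)] is
   an integer plus [k sqrt 5]. *)
Lemma abs_golden_int (m k : int) :
  abs (m%:~R + k%:~R * phi) < 1 -> abs (m%:~R + k%:~R * phi) <= s ^+ 2.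
Proof.
set x := _ + _ => x_lt1; have phi1 := abs_golden phiE.
have p_gt2 : (2 < p)%N by have := prime_gt1 p_pr; move: p_neq2; lia.
(* An odd prime has [p - 1 >= 2]. *)
have pV_le : p%:R^-1 <= s ^+ 2 by rewrite -sE sX_le //; lia.
have [p5|p_neq5] := eqVneq p 5%N.
  have abs2 : abs 2 = 1.
    by rewrite abs_nat_coprime // prime_coprime // p5.
  (* For [p = 5], [s ^ 4 = 1 / 5], so sqrt 5 has absolute value exactly [s ^+ 2]. *)
  have r5 : abs (2 * phi - 1) = s ^+ 2.
    apply/eqP; rewrite -(@eqrXn2 _ 2) ?abs_ge0 // abs_sqrt5_sqr -exprM.
    by have := abs_p; rewrite -sE p5 /= => ->.
  have -> : abs x = abs (2 * x) by rewrite absM abs2 mul1r.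
  have -> : 2 * x = (2 * m + k)%:~R + k%:~R * (2 * phi - 1).
    by rewrite /x !(intrD, intrM); ring.
  have kr : abs (k%:~R * (2 * phi - 1)) <= s ^+ 2.
    by rewrite absM r5 ler_piMl // abs_int_le1.
  apply: abs_add_le => //; apply: le_trans pV_le; apply: abs_int_lt1.
  have -> : (2 * m + k)%:~R = 2 * x - k%:~R * (2 * phi - 1).
    by rewrite /x !(intrD, intrM); ring.
  apply: abs_add_lt; first by rewrite absM abs2 mul1r.
  rewrite absN; apply: le_lt_trans kr _.
  by rewrite -[ltRHS](expr1n _ 2) ltrXn2r.
have r5 : abs (2 * phi - 1) = 1.
  apply/eqP; rewrite -(@eqrXn2 _ 2) ?abs_ge0 // abs_sqrt5_sqr expr1n.
  by rewrite abs_nat_coprime // prime_coprime // dvdn_prime2.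
apply: le_trans pV_le; have [k_lt1|k_ge1] := ltP (abs k%:~R) 1.
  have kphi : abs (k%:~R * phi) <= p%:R^-1 by rewrite absM phi1 mulr1 abs_int_lt1.
  apply: abs_add_le => //; apply: abs_int_lt1.
  have -> : m%:~R = x - k%:~R * phi by rewrite /x addrK.
  by apply: abs_add_lt; rewrite // absN absM phi1 mulr1.
have k1 : abs k%:~R = 1 by apply/eqP; rewrite eq_le abs_int_le1.
pose x' := m%:~R + k%:~R * (1 - phi).
have x'1 : abs x' = 1.
  (* [x'] differs from the non-unit [x] by the unit [k sqrt 5]. *)
  have -> : x' = - (k%:~R * (2 * phi - 1)) + x by rewrite /x' /x; ring.
  by rewrite abs_addl absN absM k1 r5 mulr1.
have xx' : x * x' = (m ^+ 2 + m * k - k ^+ 2)%:~R.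
  apply/subr0_eq; rewrite !(intrD, intrM, rmorphB, rmorphXn) /=.
  transitivity (- k%:~R ^+ 2 * (phi ^+ 2 - phi - 1)); last by rewrite phiE mulr0.
  by rewrite /x' /x; ring.
have -> : abs x = abs (x * x') by rewrite absM x'1 mulr1.
by rewrite xx' abs_int_lt1 // -xx' absM x'1 mulr1.
Qed.

(** * The interpolating functions and their values on [A_i] *)

Variable f : nat.
Hypothesis resq : residue_card abs (p ^ f).
Local Notation q := (p ^ f)%N.
Local Notation o := (omega abs q phi).
Local Notation o' := (omega abs q (1 - phi)).
Local Notation u := (phi / o).
Local Notation L := (plog abs u).

Let q_gt1 : (1 < q)%N. Proof. exact: residue_card_gt1. Qed.
Let phi1 : abs phi = 1. Proof. exact: abs_golden. Qed.
Let oq : o ^+ q.-1 = 1. Proof. by case: (omegaP resq phi1). Qed.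
Let o_phi : abs (o - phi) < 1. Proof. by case: (omegaP resq phi1). Qed.
Let o1 : abs o = 1. Proof. exact: abs_congr1 phi1 o_phi. Qed.
Let o_neq0 : o != 0. Proof. by rewrite -abs_gt0 o1 ltr01. Qed.
Let phi_neq0 : phi != 0. Proof. by rewrite -abs_gt0 phi1 ltr01. Qed.

Let conjE : 1 - phi = - phi^-1.
Proof.
apply: (mulfI phi_neq0); rewrite mulrN divff //; apply/subr0_eq.
by apply/oppr_inj; rewrite oppr0 -phiE; ring.
Qed.

(** [1 - phi = - 1 / phi], and [- o^-1] is a [(q - 1)]-st root of unity because [q - 1] is even. *)
Lemma omega_conj : o' = - o^-1.
Proof.
apply: omega_unique => //; first exact: abs_golden golden_conjE.
  rewrite exprNn -signr_odd exprVn oq invr1 mulr1.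
  have /negbTE -> // : ~~ odd q.-1.
  have := oddX p f; have -> : odd p by case: (even_prime p_pr) p_neq2 => [->|].
  by rewrite orbT; move: q_gt1; case: (q) => //= n _; rewrite -oddS => ->.
rewrite conjE; have -> : - o^-1 - - phi^-1 = (o - phi) / (o * phi).
  by field; rewrite o_neq0 phi_neq0.
by rewrite absM absV absM o1 phi1 mulr1 invr1 mulr1.
Qed.

(** The power [q - 1] removes [o] and leaves an element of Z[phi], where [abs < 1] improves to
    [abs <= s ^+ 2]. *)
Lemma abs_golden_quotient : abs (u - 1) <= s ^+ 2.
Proof.
have uE : u - 1 = - ((o - phi) / o) by field.
have u_lt1 : abs (u - 1) < 1 by rewrite uE absN absM absV o1 invr1 mulr1.
rewrite -(abs_expr_coprime_sub1 u_lt1 (coprime_predX q_gt1)).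
have := abs_expr_coprime_sub1 u_lt1 (coprime_predX q_gt1); rewrite expr_div_n oq divr1.
have [n ->] : exists n, q.-1 = n.+1 by exists q.-2; rewrite prednK // -subn1 subn_gt0.
rewrite (golden_exprS n phiE).
have -> : (fib n.+1)%:R * phi + (fib n)%:R - 1 =
    ((fib n)%:Z - 1)%:~R + (fib n.+1)%:Z%:~R * phi :> K.
  by rewrite rmorphB /= -!pmulrn; ring.
by move=> abs_eq; apply: abs_golden_int; rewrite abs_eq.
Qed.

Let Ls : abs L <= s ^+ 2. Proof. exact: abs_plog abs_golden_quotient. Qed.

(** The closed form of [F_i]; the sign [(-1) ^+ m] of the series is absorbed by the argument
    [- L]. *)
Definition Fsum i x : K :=
  o ^+ i / (2 * phi - 1) * pexp (x * L) + - (o' ^+ i / (2 * phi - 1)) * pexp (x * - L).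

Lemma Fterm_series i x : abs x <= 1 ->
  series_to abs (Fterm abs q i phi x) (Fsum i x).
Proof.
move=> x1; have Ns : abs (- L) <= s ^+ 2 by rewrite absN.
have lim := cvg_to_lincomb (o ^+ i / (2 * phi - 1)) (- (o' ^+ i / (2 * phi - 1)))
  (pexpP (abs_scale_le x1 Ls)) (pexpP (abs_scale_le x1 Ns)).
move=> eps /lim[N HN]; exists N => n /HN; congr (abs (_ - _) < _).
rewrite !mulr_sumr -big_split; apply: eq_bigr => m _ /=.
rewrite /Fterm /exp_term !exprMn [(- L) ^+ m]exprNn; field.
by rewrite natf_neq0 ?fact_gt0 // sqrt5_neq0.
Qed.

Lemma FvalE i x : abs x <= 1 -> Fval abs q i phi x = Fsum i x.
Proof.
move=> x1; have lim := Fterm_series i x1; apply: cvg_to_unique lim.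
exact: (epsilon_spec (inhabits 0) _ (ex_intro _ _ (Fterm_series i x1))).
Qed.

Lemma Fsum_lipschitz i x y : abs x <= 1 -> abs y <= 1 ->
  abs (Fsum i y - Fsum i x) <= abs (y - x) / abs (2 * phi - 1).
Proof.
move=> x1 y1; have o'1 : abs o' = 1 by rewrite omega_conj absN absV o1 invr1.
have Ns : abs (- L) <= s ^+ 2 by rewrite absN.
have -> : Fsum i y - Fsum i x =
    (o ^+ i * (pexp (y * L) - pexp (x * L)) -
     o' ^+ i * (pexp (y * - L) - pexp (x * - L))) / (2 * phi - 1).
  by rewrite /Fsum; ring.
rewrite absM absV ler_wpM2r ?invr_ge0 ?abs_ge0 //.
by apply: abs_add_le; rewrite ?absN absM absX ?o1 ?o'1 expr1n mul1r pexp_lipschitz.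
Qed.

(** The exponent [i] of [o] and [o'] may be replaced by [n]; then [o ^ n u ^ n = phi ^ n],
    [o' ^ n u ^ (- n) = (1 - phi) ^ n], and Binet's formula concludes. *)
Lemma Fsum_nat i n : n = i %[mod q - 1] -> Fsum i n%:R = (fib n)%:R.
Proof.
rewrite subn1 => ni; have o'q : o' ^+ q.-1 = 1.
  by case: (omegaP resq (abs_golden golden_conjE)).
rewrite /Fsum -(expr_mod i oq) -(expr_mod i o'q) -ni !expr_mod //.
have u_neq0 : u != 0 by rewrite mulf_neq0 ?invr_eq0.
have expL : pexp L = u := pexp_plog abs_golden_quotient.
have expNL : pexp (- L) = u^-1.
  by apply: (mulfI u_neq0); rewrite divff // -{1}expL pexpN.
rewrite !pexp_natM ?absN // expL expNL omega_conj.
have -> : (fib n)%:R = (phi ^+ n - (1 - phi) ^+ n) / (2 * phi - 1).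
  by rewrite binet mulfK ?sqrt5_neq0.
rewrite mulNr ![_ / (2 * phi - 1) * _]mulrAC -mulrBl -!exprMn conjE.
by congr ((_ ^+ _ - _ ^+ _) / _); field; rewrite ?o_neq0 ?phi_neq0.
Qed.

(** An integer close to [x] is replaced by a natural number, then moved into the class of [i] by the
    Chinese remainder theorem for the coprime moduli [p ^ k] and [q - 1]. *)
Lemma progression_dense i x (delta : R) : is_Zp abs x -> 0 < delta ->
  exists2 n : nat, n = i %[mod q - 1] & abs (n%:R - x) < delta.
Proof.
move=> Zx delta_gt0; have [_ [[z ->]] xz] := Zx _ delta_gt0.
have pV_lt1 : p%:R^-1 < 1 :> R by rewrite invf_lt1 ?ltr0n ?ltr1n ?prime_gt1.
have pV_ge0 : 0 <= p%:R^-1 :> R by rewrite invr_ge0 ler0n.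
have [k pk] := geometric_lt pV_ge0 pV_lt1 delta_gt0.
have abs_pk y d : abs y <= 1 -> y * (p ^ k)%:R = d -> abs d < delta.
  move=> y1 <-; apply: le_lt_trans pk.
  by rewrite absM natrX absX abs_p ler_piMl // exprn_ge0.
have [a za] : exists a : nat, abs (a%:R - z%:~R) < delta.
  case: z {xz} => a; first by exists a; rewrite -pmulrn subrr abs0.
  (* This is the negative integer [- (a + 1)] shifted by [(a + 1) p ^ k]. *)
  exists (a.+1 * (p ^ k).-1)%N; apply: (abs_pk a.+1%:R); first exact: abs_nat_le1.
  rewrite NegzE mulrNz -pmulrn opprK -natrM -natrD; congr _%:R.
  by rewrite addnC -mulnS prednK // expn_gt0 p_gt0.
have co : coprime (p ^ k) (q - 1) by rewrite subn1 coprimeXl // coprime_predX.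
exists (chinese (p ^ k) (q - 1) a i); first exact: chinese_modr.
apply: (abs_dist_lt (y := z%:~R)); last by rewrite absB.
apply: (abs_dist_lt (y := a%:R)) => //.
have := chinese_modl co a i; move: (chinese _ _ _ _) => n na.
apply: (abs_pk ((n %/ p ^ k)%:Z - (a %/ p ^ k)%:Z)%:~R); first exact: abs_int_le1.
rewrite {2}(divn_eq n (p ^ k)) {2}(divn_eq a (p ^ k)) na rmorphB /= -!pmulrn.
by rewrite !natrD !natrM; ring.
Qed.

End Golden.
End PadicAbs.

Theorem theorem5p2 (p : nat) (R : realType) (K : fieldType) (abs : K -> R)
    (phi : K) (f i : nat) :
  prime p -> p != 2%N ->
  padic_abs abs p -> complete_abs abs ->
  phi ^+ 2 - phi - 1 = 0 ->
  (forall x : K, exists a b, [/\ is_Qp abs a, is_Qp abs b & x = a + b * phi]) ->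
  residue_card abs (p ^ f) ->
  (i <= p ^ f - 2)%N ->
  [/\ (forall x, is_Zp abs x ->
         series_to abs (Fterm abs (p ^ f) i phi x) (Fval abs (p ^ f) i phi x)
         /\ is_Zp abs (Fval abs (p ^ f) i phi x)),
      (forall x, is_Zp abs x -> forall eps : R, 0 < eps ->
         exists2 delta : R, 0 < delta & forall y, is_Zp abs y ->
           abs (y - x) < delta ->
           abs (Fval abs (p ^ f) i phi y - Fval abs (p ^ f) i phi x) < eps)
    & forall n : nat, n = i %[mod p ^ f - 1] ->
         Fval abs (p ^ f) i phi n%:R = (fib n)%:R].
Proof.
move=> p_pr p_neq2 absP abs_complete phiE _ resq _.
have p_gt1 := prime_gt1 p_pr.
have [||s [s_gt0 s_lt1 sE]] := @exists_root_invr R p.-1 p%:R.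
- by rewrite -subn1 subn_gt0.
- by rewrite ltr1n.
have Zp_le1 x : is_Zp abs x -> abs x <= 1.
  move=> /(_ 1 ltr01)[_ [[z ->]] xz]; rewrite -[x](subrK z%:~R).
  by apply: (abs_add_le absP (ltW xz)); apply: abs_int_le1 absP _.
have nat_le1 (n : nat) : abs n%:R <= 1 by apply: abs_nat_le1 absP _.
pose F := Fsum abs p phi f i.
have FE x : abs x <= 1 -> Fval abs (p ^ f) i phi x = F x.
  exact: (FvalE p_pr absP abs_complete s_gt0 s_lt1 sE p_neq2 phiE resq).
have Fval_nat n : n = i %[mod p ^ f - 1] -> Fval abs (p ^ f) i phi n%:R = (fib n)%:R.
  move=> ni; rewrite FE //.
  exact: (Fsum_nat p_pr absP abs_complete s_gt0 s_lt1 sE p_neq2 phiE resq ni).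
have Fval_cont x : is_Zp abs x -> forall eps : R, 0 < eps ->
    exists2 delta : R, 0 < delta & forall y, is_Zp abs y -> abs (y - x) < delta ->
      abs (Fval abs (p ^ f) i phi y - Fval abs (p ^ f) i phi x) < eps.
  move=> Zx eps eps_gt0; have r_gt0 : 0 < abs (2 * phi - 1).
    by rewrite (abs_gt0 absP) (sqrt5_neq0 p_pr absP phiE).
  (* [F] is Lipschitz with constant [1 / abs (2 * phi - 1)]. *)
  exists (eps * abs (2 * phi - 1)); first exact: mulr_gt0.
  move=> y Zy yx; rewrite !FE ?Zp_le1 //.
  apply: le_lt_trans (_ : abs (y - x) / abs (2 * phi - 1) < _); last by rewrite ltr_pdivrMr.
  by apply: (Fsum_lipschitz p_pr absP abs_complete s_gt0 s_lt1 sE p_neq2 phiE resq);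
    apply: Zp_le1.
split=> // x Zx; split.
  rewrite FE ?Zp_le1 //.
  by apply: (Fterm_series p_pr absP abs_complete s_gt0 s_lt1 sE p_neq2 phiE resq);
    apply: Zp_le1.
move=> eps eps_gt0; have [delta delta_gt0 Fd] := Fval_cont x Zx _ eps_gt0.
(* At a point of [A_i] close to [x] the value is a Fibonacci number, which is the integer
   approximation sought. *)
have [n ni nx] := progression_dense p_pr absP resq i Zx delta_gt0.
exists (fib n)%:R; split; first by exists (fib n); rewrite -pmulrn.
rewrite (absB absP) -Fval_nat //; apply: Fd => // e e_gt0.
by exists n%:R; split; [exists n; rewrite -pmulrn | rewrite subrr (abs0 absP)].
Qed.
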